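(* Let $r\geq 1$ and let $\mathcal{F}_r$ be the set of overpartitions in which the first occurrence of a number may be overlined and there are no $r$ consecutive parts which are all non-overlined. Then $\mathcal{F}_r$ is a separable overpartition class.
   Context: An overpartition (in the ''first occurrence'' convention) is a partition in which the first occurrence of a number may be overlined; parts are listed in non-increasing order of size, with $\overline{t}$ listed before the non-overlined copies of $t$. Consecutiveness refers to positions in this list. For a positive integer $t$ and nonnegative integer $d$, $\overline{t}+d=\overline{t+d}$. A separable overpartition class is a set $\mathcal{P}$ of overpartitions for which there is a subset $\mathcal{B}\subset\mathcal{P}$ (the basis) such that for each $m\geq 1$ the number of overpartitions in $\mathcal{B}$ with $m$ parts is finite, every overpartition in $\mathcal{P}$ with $m$ parts is uniquely of the form $(b_1+\pi_1,\ldots,b_m+\pi_m)$ with $(b_1,\ldots,b_m)\in\mathcal{B}$ and $(\pi_1,\ldots,\pi_m)$ a non-increasing sequence of nonnegative integers, and all overpartitions of this form lie in $\mathcal{P}$. *)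

(* Defs.v *)
From mathcomp Require Import all_boot.
From mathcomp Require Import classical_sets cardinality.

Set Implicit Arguments.
Unset Strict Implicit.
Unset Printing Implicit Defensive.

Local Open Scope classical_set_scope.

(* (t, true) stands for the overlined part t, (t, false) for the
   non-overlined one. *)
Definition part : Type := (nat * bool)%type.

Definition psize (p : part) : nat := p.1.
Definition overlined (p : part) : bool := p.2.

(* q may be listed immediately after p: the sizes do not increase, and among
   equal sizes only the part listed first may be overlined. *)
Definition may_follow (p q : part) : bool :=
  (psize q < psize p) || ((psize q == psize p) && ~~ overlined q).

Definition is_overpartition (l : seq part) : bool :=
  all (fun p => 0 < psize p) l && sorted may_follow l.

Definition overpartitions : set (seq part) := [set l | is_overpartition l].

Definition add_part (p : part) (d : nat) : part := (psize p + d, overlined p).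

(* zip truncates to the shorter list; this is only used for lists of equal
   length. *)
Definition add_parts (b : seq part) (pi : seq nat) : seq part :=
  [seq add_part x.1 x.2 | x <- zip b pi].

Definition is_basis (P B : set (seq part)) : Prop :=
  B `<=` P /\
  forall m : nat, 1 <= m ->
    [/\ finite_set [set b | B b /\ size b = m],
        (forall l, P l -> size l = m ->
           exists! bpi : seq part * seq nat,
             [/\ B bpi.1, size bpi.1 = m, size bpi.2 = m,
                 sorted geq bpi.2 & l = add_parts bpi.1 bpi.2])
      & (forall (b : seq part) (pi : seq nat),
           B b -> size b = m -> size pi = m -> sorted geq pi ->
           P (add_parts b pi))].

Definition separable_overpartition_class (P : set (seq part)) : Prop :=
  P `<=` overpartitions /\ exists B : set (seq part), is_basis P B.

Definition F_class (r : nat) : set (seq part) :=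
  [set l | is_overpartition l /\
           forall s : seq part, infix s l -> size s = r ->
             ~~ all (fun p => ~~ overlined p) s].

(* Main.v *)
(** Membership in [F_class r] constrains an overpartition only through its
    overlining pattern, and every class defined by a condition on the pattern is
    separable.  Indeed, among the overpartitions with a given pattern there is a
    least one, in which each part has size one plus the number of overlined
    parts listed after it.  These least overpartitions form the basis: an
    overpartition with the same pattern differs from the least one by a
    non-increasing sequence, because adjacent parts of the least one are as
    close in size as the pattern allows. *)
Require Import Defs.
From mathcomp Require Import all_boot.
From mathcomp Require Import classical_sets cardinality.
From mathcomp Require Import boolp zify.

Set Implicit Arguments.
Unset Strict Implicit.
Unset Printing Implicit Defensive.

Local Open Scope classical_set_scope.

Lemma infix_mapP (T U : eqType) (f : T -> U) (t : seq U) (s : seq T) :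
  reflect (exists2 s', infix s' s & t = map f s') (infix t (map f s)).
Proof.
apply: (iffP idP); last first.
  by case=> s' /infixP[p [q ->]] ->; rewrite !map_cat infix_infix.
case/infixP=> p [q eq_s].
exists (take (size t) (drop (size p) s)).
  exact: infix_trans (infix_take _ _) (infix_drop _ _).
by rewrite map_take map_drop eq_s drop_size_cat // take_size_cat.
Qed.

Lemma finite_seq_of_size (T : finType) (m : nat) :
  finite_set [set s : seq T | size s = m].
Proof.
apply: (@sub_finite_set _ _ ((fun t : m.-tuple T => val t) @` setT)).
  by move=> s /eqP szs; exists (Tuple szs).
exact/finite_image/finite_finset.
Qed.

Lemma may_followE (p q : part) :
  may_follow p q = (psize q + overlined q <= psize p).
Proof. by rewrite /may_follow; case: (overlined q) => /=; lia. Qed.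

(* The sentinel [(0, true)] may follow exactly the parts of positive size. *)
Lemma is_overpartition_cons (p : part) (l : seq part) :
  is_overpartition (p :: l) =
  may_follow p (head (0, true) l) && is_overpartition l.
Proof.
rewrite /is_overpartition; case: l => [|q l] /=.
  by rewrite !andbT may_followE addn1.
rewrite may_followE; case: (path _ _ _); rewrite ?andbF // !andbT.
by case: (all _ _); lia.
Qed.

Lemma count_overlined_lt (p : part) (l : seq part) :
  is_overpartition (p :: l) -> count overlined l < psize p.
Proof.
elim: l p => [|q l IHl] p; rewrite is_overpartition_cons may_followE.
  by rewrite andbT.
by case/andP=> /= leqp /IHl; lia.
Qed.

Lemma add_parts_cons (p : part) (b : seq part) (d : nat) (pi : seq nat) :
  add_parts (p :: b) (d :: pi) = add_part p d :: add_parts b pi.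
Proof. by []. Qed.

Lemma overlined_add_parts (b : seq part) (pi : seq nat) :
  size b <= size pi -> map overlined (add_parts b pi) = map overlined b.
Proof. by move=> szb; rewrite -[in RHS](unzip1_zip szb) -!map_comp. Qed.

Lemma add_parts_inj (b : seq part) (pi pi' : seq nat) :
  size pi <= size b -> size pi' <= size b ->
  add_parts b pi = add_parts b pi' -> pi = pi'.
Proof.
elim: b pi pi' => [|p b IHb] [|d pi] [|d' pi'] //= szpi szpi'.
by rewrite !add_parts_cons => -[/addnI-> /IHb->].
Qed.

Lemma is_overpartition_add_parts (b : seq part) (pi : seq nat) :
  is_overpartition b -> sorted geq pi -> is_overpartition (add_parts b pi).
Proof.
elim: b pi => [|p b IHb] [|d pi] // opb pi_s.
have p_gt0 : 0 < psize p := leq_ltn_trans (leq0n _) (count_overlined_lt opb).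
move: opb; rewrite add_parts_cons !is_overpartition_cons => /andP[leqp ob].
rewrite {}IHb ?(path_sorted pi_s) // andbT.
case: b pi leqp pi_s p_gt0 {ob} => [|q b] [|e pi] /=;
  rewrite !may_followE /add_part /psize /overlined /=; lia.
Qed.

Fixpoint least_overpartition (o : seq bool) : seq part :=
  if o is x :: o' then ((count id o').+1, x) :: least_overpartition o'
  else [::].

Fixpoint excess (l : seq part) : seq nat :=
  if l is p :: l' then (psize p - (count overlined l').+1) :: excess l'
  else [::].

Lemma overlined_least_overpartition :
  cancel least_overpartition (map overlined).
Proof. by elim=> //= x o ->. Qed.

Lemma size_least_overpartition (o : seq bool) :
  size (least_overpartition o) = size o.
Proof. by rewrite -(size_map overlined) overlined_least_overpartition. Qed.

Lemma is_overpartition_least (o : seq bool) :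
  is_overpartition (least_overpartition o).
Proof.
elim: o => // x o IHo; rewrite is_overpartition_cons IHo may_followE andbT.
by case: o {IHo} => //= y o; rewrite /psize /overlined /=; lia.
Qed.

Lemma size_excess (l : seq part) : size (excess l) = size l.
Proof. by elim: l => //= p l ->. Qed.

Lemma sorted_excess (l : seq part) :
  is_overpartition l -> sorted geq (excess l).
Proof.
elim: l => // p [|q l] IHl // opql.
have /andP[leqp oql] : may_follow p q && is_overpartition (q :: l).
  by rewrite is_overpartition_cons in opql.
have /= -> := IHl oql; rewrite andbT.
by move: leqp (count_overlined_lt oql); rewrite may_followE /=; lia.
Qed.

Lemma add_parts_excess (l : seq part) : is_overpartition l ->
  add_parts (least_overpartition (map overlined l)) (excess l) = l.
Proof.
elim: l => // p l IHl opl; have ltp := count_overlined_lt opl.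
move: opl; rewrite is_overpartition_cons => /andP[_ /IHl {}IHl].
rewrite add_parts_cons {}IHl /add_part /= count_map (subnKC ltp).
by rewrite -surjective_pairing.
Qed.

Lemma add_parts_least_inj (o o' : seq bool) (pi pi' : seq nat) :
  size pi = size o -> size pi' = size o' ->
  add_parts (least_overpartition o) pi =
    add_parts (least_overpartition o') pi' ->
  o = o' /\ pi = pi'.
Proof.
move=> szpi szpi' eq_add; have eq_o : o = o'.
  have /= := congr1 (map overlined) eq_add.
  by rewrite !overlined_add_parts ?size_least_overpartition ?szpi ?szpi' //
             !overlined_least_overpartition.
split=> //; rewrite -{}eq_o in szpi' eq_add.
by apply: add_parts_inj eq_add; rewrite size_least_overpartition ?szpi ?szpi'.
Qed.

Definition overlining_class (Q : set (seq bool)) : set (seq part) :=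
  [set l | is_overpartition l /\ Q (map overlined l)].

Lemma is_basis_least_overpartition (Q : set (seq bool)) :
  is_basis (overlining_class Q) (least_overpartition @` Q).
Proof.
have least_in o : Q o -> overlining_class Q (least_overpartition o).
  move=> Qo; split; first exact: is_overpartition_least.
  by rewrite overlined_least_overpartition.
split=> [_ [o Qo <-]|m _]; first exact: least_in.
split.
- apply: sub_finite_set (finite_image least_overpartition
    (finite_seq_of_size bool m)) => _ [[o _ <-]].
  by rewrite size_least_overpartition => szo; exists o.
- move=> l [ol Ql] szl.
  exists (least_overpartition (map overlined l), excess l); split.
    split; rewrite /= ?size_least_overpartition ?size_excess ?size_map //.
    + by exists (map overlined l).
    + exact: sorted_excess.
    + by rewrite add_parts_excess.
  move=> [_ pi] [/= [o _ <-]]; rewrite size_least_overpartition => szo szpi _.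
  rewrite -{1}(add_parts_excess ol) => /add_parts_least_inj[].
  + by rewrite size_excess size_map.
  + by rewrite szpi szo.
  + by move=> -> ->.
- move=> _ pi [o Qo <-] szo szpi pi_s; split.
    by apply: is_overpartition_add_parts => //; exact: is_overpartition_least.
  by rewrite overlined_add_parts ?szo ?szpi // overlined_least_overpartition.
Qed.

Lemma separable_overlining_class (Q : set (seq bool)) :
  separable_overpartition_class (overlining_class Q).
Proof.
split; first by move=> l [].
by exists (least_overpartition @` Q); exact: is_basis_least_overpartition.
Qed.

Lemma all_nonoverlinedE (s : seq part) :
  all (fun p => ~~ overlined p) s = (map overlined s == nseq (size s) false).
Proof. by elim: s => //= p s ->; rewrite eqseq_cons; case: (overlined p). Qed.

Lemma F_classE (r : nat) :
  F_class r = overlining_class [set o | ~~ infix (nseq r false) o].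
Proof.
apply/predeqP=> l; split=> -[ol Fl]; split=> //.
- apply/infix_mapP=> -[s sl eq_s].
  have szs : size s = r by rewrite -(size_map overlined) -eq_s size_nseq.
  by have := Fl s sl szs; rewrite all_nonoverlinedE -eq_s szs eqxx.
- move=> s sl szs; apply: contra Fl.
  by rewrite all_nonoverlinedE szs => /eqP eq_s; apply/infix_mapP; exists s.
Qed.

Theorem theorem5p2 (r : nat) (hr : 1 <= r) :
  separable_overpartition_class (F_class r).
Proof. by rewrite F_classE; exact: separable_overlining_class. Qed.
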